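(* Let $X$ be a Banach space and let $T:X\to X$ be a mapping (not necessarily continuous) which maps bounded sets into relatively compact ones. Let $\mathbb{T}$ denote the closed--convex envelope of $T$ (on $X$). Assume that there exists $R>0$ such that, for $x\in X$, the condition $x\in\sigma\,\mathbb{T}x$ for some $\sigma\in[0,1]$ implies $\|x\|<R$. Let $\Omega=B_R(0)$ be the open ball centered at the origin with radius $R$, and let $\mathbb{T}_\Omega$ be the closed--convex envelope of the restriction $T|_{\overline{\Omega}}$. If $$\{x\}\cap\mathbb{T}_\Omega x\subset\{Tx\}\quad\text{for every }x\in\overline{\Omega}\cap\mathbb{T}_\Omega\,\overline{\Omega},$$ then $T$ has a fixed point in $B_R(0)$.
   Context: For an open set $U\subset X$ and $S:\overline{U}\to X$, the closed--convex envelope of $S$ is the multivalued map $\mathbb{S}:\overline{U}\to2^X$, $\mathbb{S}x=\bigcap_{\varepsilon>0}\overline{\mathrm{co}}\,S(\overline{B}_\varepsilon(x)\cap\overline{U})$, where $\overline{B}_\varepsilon(x)$ is the closed ball of center $x$ and radius $\varepsilon$ and $\overline{\mathrm{co}}$ denotes the closed convex hull; $\mathbb{S}\,\overline{U}=\bigcup_{x\in\overline{U}}\mathbb{S}x$. Thus $\mathbb{T}x=\bigcap_{\varepsilon>0}\overline{\mathrm{co}}\,T(\overline{B}_\varepsilon(x))$ (case $U=X$) and $\mathbb{T}_\Omega x=\bigcap_{\varepsilon>0}\overline{\mathrm{co}}\,T(\overline{B}_\varepsilon(x)\cap\overline{\Omega})$. Also $\sigma\,\mathbb{T}x=\{\sigma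 y: y\in\mathbb{T}x\}$. *)

(* Defs.v *)
From HB Require Import structures.
From mathcomp Require Import all_boot all_order all_algebra.
From mathcomp Require Import all_classical all_reals all_analysis.
Import Order.TTheory GRing.Theory Num.Theory.
Import numFieldNormedType.Exports.

Set Implicit Arguments.
Unset Strict Implicit.
Unset Printing Implicit Defensive.

Local Open Scope classical_set_scope.
Local Open Scope ring_scope.

Definition closed_convex_hull (R : realType) (X : normedModType R)
    (A : set X) : set X :=
  smallest [set C : set X | closed C /\ convex_set C] A.

(* A map S defined on closure U is represented by a total map: the envelope
   only involves the values of S on closure U, so [cc_envelope U S] is also the
   envelope of the restriction of S to closure U.  The envelope of a map on the
   whole space is the case [U = setT].  It is meant for U open and x in
   closure U. *)
Definition cc_envelope (R : realType) (X : normedModType R)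
    (U : set X) (S : X -> X) (x : X) : set X :=
  \bigcap_(e in [set e : R | 0 < e])
    closed_convex_hull (S @` (closed_ball x e `&` closure U)).

(* Main.v *)
Require Import Defs.
From mathcomp Require Import all_boot all_order all_algebra.
From mathcomp Require Import all_classical all_reals all_analysis.
From mathcomp Require Import zify ring lra.
Import Order.TTheory GRing.Theory Num.Theory.
Import numFieldNormedType.Exports.

(** The theorem is a Leray-Schauder alternative for the closed-convex
    envelope of T, reduced to Brouwer's theorem by Schauder's method.

    Let D be the closed ball of radius r, K the closed convex hull of T(D) and
    rho the radial retraction of X onto D.  K is compact by Mazur's theorem
    ([mazur]).  The heart of the matter is a point y of K that belongs to the
    envelope of T restricted to D, taken at rho y ([cc_envelope_fixed]).  Put
    x = rho y.  If |y| > r, then x = s y with s = r / |y| <= 1, so x has norm r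
    and lies in s T^ x, where T^ is the envelope of T on X, which contains that
    of the restriction: this contradicts the a priori bound.  Hence
    |y| <= r and x = y lies in its own envelope; the a priori bound with s = 1
    gives |x| < r, and the hypothesis on the points of D that lie in
    their own envelope forces T x = x.

    The point y is obtained as a limit of approximate solutions.  For e > 0,
    cover the compact set rho(K) by finitely many balls of radius e centred at
    points z_i of rho(K), with a subordinate partition of unity w_i.  The map
    sending the barycentric coordinates t to those given by w_i at
    rho (sum_i t_i T z_i) is a continuous self-map of a standard simplex.  A
    fixed point of it produces y = sum_i t_i T z_i in which only centres z_i
    at distance less than e from rho y occur ([approx_envelope_fixed]).
    Compactness of K removes the e.

    Brouwer's theorem on the simplex ([brouwer_simplex]) is derived from a
    combinatorial lemma of Scarf ([scarf]), which replaces triangulations and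
    Sperner's lemma by a parity argument on finite families of total orders;
    here the orders compare the grid points of the simplex coordinate by
    coordinate.

    The limits e -> 0 rest on the covering form of compactness: a property
    that holds locally, for all small enough e, at every point of a compact set
    holds for all small enough e on the whole set. *)

Set Implicit Arguments.
Unset Strict Implicit.
Unset Printing Implicit Defensive.

(** * Scarf's lemma on families of total orders *)

Section Scarf.
Import mathcomp.boot.fintype mathcomp.boot.finset.
Local Open Scope set_scope.
Local Open Scope nat_scope.

(** A surjection that misses injectivity by one has a single collision, and
    removing either member of the colliding pair is the only way to remain
    surjective after deleting a point.  Both sides of the double counting below
    rest on this. *)
Lemma imsetD1_defect1 (U V : finType) (f : U -> V) (A : {set U}) (B : {set V}) :
  f @: A = B -> #|A| = #|B|.+1 ->
  exists i j, [/\ i \in A, j \in A, i != j &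
    forall k, k \in A -> (f @: (A :\ k) == B) = (k \in [set i; j])].
Proof.
move=> fA cAB; have /dinjectivePn[i iA [j]] : ~~ dinjectiveb f A.
  apply/negP => /dinjectiveP/imset_injP.
  by rewrite fA cAB -[_ == _]/(#|B| == #|B|.+1) (ltn_eqF (ltnSn _)).
rewrite !inE => /andP[ji jA] fij.
have drop k l : k \in A -> l \in A -> l != k -> f k = f l -> f @: (A :\ k) = B.
  move=> kA lA lk fkl; apply/eqP; rewrite -fA eqEsubset imsetS ?subsetDl//=.
  apply/subsetP => _ /imsetP[x xA ->].
  have [->|xk] := eqVneq x k; first by rewrite fkl imset_f // !inE lk.
  by rewrite imset_f // !inE xk.
exists i, j; split => // [|k kA]; first by rewrite eq_sym.
rewrite !inE; apply/eqP/orP => [fk|[/eqP->|/eqP->]]; last 2 first.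
- by apply: (drop i j).
- by apply: (drop j i); rewrite // eq_sym.
apply/orP/negPn/negP; rewrite negb_or => /andP[ki kj].
have : {in A :\ k &, injective f}.
  apply/imset_injP; rewrite fk.
  by move: cAB; rewrite (cardsD1 k) kA add1n => -[->].
move=> /(_ i j); rewrite !inE iA jA eq_sym ki eq_sym kj => /(_ isT isT fij).
by move=> /eqP; rewrite eq_sym (negPf ji).
Qed.

Lemma sum_imsetD1_defect1 (U V : finType) (f : U -> V) (A : {set U})
    (B : {set V}) :
  f @: A = B -> #|A| = #|B|.+1 -> \sum_(k in A) (f @: (A :\ k) == B) = 2.
Proof.
move=> fA cAB; have [i [j [iA jA ij fk]]] := imsetD1_defect1 fA cAB.
rewrite (eq_bigr _ (fun k kA => congr1 nat_of_bool (fk k kA))).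
rewrite (bigID (mem [set i; j])) /= [X in _ + X]big1 ?addn0; last first.
  by move=> k /andP[_ kn]; apply/eqP; rewrite eqb0.
rewrite (eq_bigl (mem [set i; j])) => [|k]; last first.
  rewrite /= !inE; have [->|] := eqVneq k i; first by rewrite iA.
  by have [->|] := eqVneq k j; rewrite ?jA ?andbF.
rewrite (eq_bigr (fun=> 1)) => [|k kij]; first by rewrite sum1_card cards2 ij.
by rewrite (_ : k \in _).
Qed.

(** Reindexing along (C, k) |-> (C minus k, k), the pairs with k in C being in
    bijection with those where k is outside. *)
Lemma sum_setD1_setU1 (U : finType) (H : {set U} -> {set U} -> nat) :
  \sum_(C : {set U}) \sum_(k in C) H C (C :\ k) =
  \sum_(C : {set U}) \sum_(k in ~: C) H (k |: C) C.
Proof.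
rewrite (exchange_big_dep xpredT)//= [RHS](exchange_big_dep xpredT)//=.
apply: eq_bigr => k _.
rewrite (reindex_onto (fun C => k |: C) (fun C => C :\ k)) => [|C /setD1K//].
apply: eq_big => C => [|/andP[_ /eqP ->//]].
rewrite !inE eqxx /=; apply/eqP/idP => [<-|kC]; first by rewrite !inE eqxx.
by rewrite setU1K.
Qed.

(** The total order number i on T is encoded by an injective rank [rk i]. *)
Variables (T I : finType) (rk : I -> T -> nat).
Hypothesis rk_inj : forall i, injective (rk i).

Implicit Types (A B : {set T}) (C D : {set I}).

(** For nonempty A: no point of T lies strictly above the minimum of A for
    every order in C, so that the simplex cut out by these minima has no point
    of T in its interior. *)
Definition dominant (A : {set T}) (C : {set I}) :=
  [forall x, [exists i in C, [forall a in A, rk i x <= rk i a]]].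

Lemma dominantP A C :
  reflect (forall x, exists2 i, i \in C & forall a, a \in A -> rk i x <= rk i a)
          (dominant A C).
Proof.
apply: (iffP forallP) => H x.
  by have /existsP[i /andP[iC /forall_inP]] := H x; exists i.
have [i iC xA] := H x; apply/existsP; exists i; rewrite iC /=.
exact/forall_inP.
Qed.

Lemma dominantS (A B : {set T}) (C D : {set I}) :
  A \subset B -> C \subset D -> dominant B C -> dominant A D.
Proof.
move=> /subsetP AB /subsetP CD /dominantP H.
apply/dominantP => x; have [i iC xB] := H x.
by exists i; [exact: CD|move=> a /AB; exact: xB].
Qed.

Section lowest.
Variables (A : {set T}) (a0 : T) (a0A : a0 \in A).

Definition lowest i := [arg min_(a < a0 in A) rk i a].

Lemma lowest_in i : lowest i \in A.
Proof. by rewrite /lowest; case: arg_minnP. Qed.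

Lemma lowest_le i a : a \in A -> rk i (lowest i) <= rk i a.
Proof. by rewrite /lowest; case: arg_minnP => // b _; apply. Qed.

Lemma lowestP i b : b \in A -> (forall a, a \in A -> rk i b <= rk i a) ->
  lowest i = b.
Proof.
move=> bA bmin; apply: (@rk_inj i); apply/eqP.
by rewrite eqn_leq lowest_le ?bmin ?lowest_in.
Qed.

Lemma dominant_lowestP C :
  reflect (forall x, exists2 i, i \in C & rk i x <= rk i (lowest i))
          (dominant A C).
Proof.
apply: (iffP (dominantP _ _)) => H x; have [i iC xi] := H x; exists i => //.
  by apply: xi; exact: lowest_in.
by move=> a aA; apply: leq_trans xi _; exact: lowest_le.
Qed.

(** Dominance applied to an element a of A singles out an order of C for which
    a is below all of A, hence is its minimum. *)
Lemma dominant_lowest_imset C : dominant A C -> lowest @: C = A.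
Proof.
move=> /dominantP dAC; apply/eqP; rewrite eqEsubset; apply/andP; split.
  by apply/subsetP => _ /imsetP[i _ ->]; exact: lowest_in.
apply/subsetP => a aA; have [i iC ai] := dAC a.
by apply/imsetP; exists i => //; rewrite (lowestP aA ai).
Qed.

End lowest.

(** Rooms are the dominant pairs with as many points as orders; a door between
    them is a dominant pair with one point less, and [degree] counts the rooms
    reached from a door by dropping an order or adding a point. *)
Definition room A C := dominant A C && (#|A| == #|C|).

Definition degree A C :=
  \sum_(k in C) room A (C :\ k) + \sum_(x in ~: A) room (x |: A) C.

Lemma room_doorP A C : degree A C != 0 -> dominant A C /\ #|C| = #|A|.+1.
Proof.
rewrite addn_eq0 negb_and !sum_nat_eq0 !negb_forall.
case/orP => /existsP[k]; rewrite negb_imply eqb0 negbK.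
  move=> /andP[kC /andP[dA /eqP cA]]; split.
    by apply: dominantS dA => //; exact: subsetDl.
  by rewrite cA (cardsD1 k C) kC.
rewrite in_setC => /andP[kA /andP[dA /eqP cA]]; split.
  by apply: dominantS dA => //; exact: subsetUr.
by rewrite -cA cardsU1 kA.
Qed.

(** Exactly two orders i, j share their minimal element in A.  For k among
    them, let M k be the set of points that violate dominance of (A, C minus k).
    If M k is empty, then dropping k gives a room; otherwise adding x gives a
    room, where x is the maximum of M k for the order k.  Each of i and j thus
    opens on one room, and no others exist. *)
Lemma degree_nonempty A C : A != set0 -> dominant A C -> #|C| = #|A|.+1 ->
  degree A C = 2.
Proof.
move=> /set0Pn[a0 a0A] dAC cAC.
have lowC := dominant_lowest_imset a0A dAC; set low := lowest A a0 in lowC.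
have [i [j [iC jC ij lowCk]]] := imsetD1_defect1 lowC cAC.
pose M k := [set x | [forall l in C :\ k, rk l (low l) < rk l x]].
have MP k x : reflect (forall l, l \in C -> l != k -> rk l (low l) < rk l x)
    (x \in M k).
  rewrite inE; apply: (iffP forall_inP) => H l.
    by move=> lC lk; apply: H; rewrite !inE lk.
  by rewrite !inE => /andP[lk lC]; exact: H.
pose top k := [set x in M k | [forall y in M k, rk k y <= rk k x]].
have topP k x : reflect (x \in M k /\ forall y, y \in M k -> rk k y <= rk k x)
    (x \in top k).
  rewrite [x \in top k]in_set.
  by apply: (iffP andP) => -[? ?]; split => //; exact/forall_inP.
have roomD k : k \in C -> room A (C :\ k) = (M k == set0).
  move=> kC; rewrite /room.
  have -> : #|A| == #|C :\ k|.
    by move: cAC; rewrite (cardsD1 k) kC add1n => -[->].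
  rewrite andbT; apply/(dominant_lowestP a0A)/eqP => [H|M0 x].
    apply/setP => x; rewrite in_set0; apply/negP => /MP Mx.
    have [l] := H x; rewrite !inE => /andP[lk lC].
    by rewrite leqNgt Mx.
  have : x \notin M k by rewrite M0 in_set0.
  rewrite in_set negb_forall => /existsP[l].
  by rewrite negb_imply -leqNgt => /andP[lC xl]; exists l.
have roomU x : (x \in ~: A) && room (x |: A) C = (x \in top i :|: top j).
  rewrite in_setU in_setC; apply/idP/idP.
    move=> /andP[xA /andP[dA' /eqP cA']].
    have a0A' : a0 \in x |: A by rewrite !inE a0A orbT.
    have lowC' := dominant_lowest_imset a0A' dA'.
    set low' := lowest _ _ in lowC'.
    have linj : {in C &, injective low'} by apply/imset_injP; rewrite lowC' cA'.
    have : x \in low' @: C by rewrite lowC' !inE eqxx.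
    move=> /imsetP[k kC xk].
    have lowE l : l \in C -> l != k -> low' l \in A /\ low l = low' l.
      move=> lC lk; have lA : low' l \in A.
        have := lowest_in a0A' l; rewrite -/low' in_setU1 => /orP[|//].
        rewrite xk => /eqP /(linj _ _ lC kC) lk'.
        by rewrite lk' eqxx in lk.
      split=> //; apply: lowestP => // a aA; apply: lowest_le => //.
      by rewrite in_setU1 aA orbT.
    have xM : x \in M k.
      apply/MP => l lC lk; have [lA ->] := lowE l lC lk.
      rewrite ltn_neqAle lowest_le ?andbT //; last by rewrite !inE eqxx.
      apply/negP => /eqP/rk_inj lx; rewrite -/low' in lx.
      by rewrite -lx lA in xA.
    have xtop : x \in top k.
      apply/topP; split=> // y /MP yM.
      have /dominantP/(_ y)[l lC yl] := dA'.
      have [lk|lk] := eqVneq l k; first by rewrite -lk yl // !inE eqxx.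
      have [lA le] := lowE l lC lk.
      have := yl _ (lowest_in a0A' l).
      by rewrite -/low' -le leqNgt yM.
    have kij : k \in [set i; j].
      rewrite -lowCk //; apply/eqP/setP => a; apply/imsetP/idP.
        by move=> [l _ ->]; exact: lowest_in.
      move=> aA; have : a \in low' @: C by rewrite lowC' !inE aA orbT.
      move=> /imsetP[l lC al].
      have lk : l != k by apply: contraNneq xA => lk; rewrite xk -lk -al.
      by exists l; rewrite ?inE ?lk //; have [_ ->] := lowE l lC lk.
    by move: kij; rewrite in_set2 => /orP[] /eqP kE; rewrite -kE xtop ?orbT.
  move=> xij; have [k kij xt] : exists2 k, k \in [set i; j] & x \in top k.
    by case/orP: xij; [exists i|exists j]; rewrite // !inE eqxx ?orbT.
  have kC : k \in C by move: kij; rewrite !inE => /orP[] /eqP->.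
  move: kij; rewrite -lowCk // => /eqP lowk.
  move/topP: xt => [/MP xM xmax].
  have xA : x \notin A.
    apply/negP => xA; have := xA; rewrite -lowk => /imsetP[l].
    rewrite !inE => /andP[lk lC] xl; have := xM l lC lk.
    by rewrite xl ltnn.
  rewrite xA /= /room cardsU1 xA cAC add1n eqxx andbT.
  apply/dominantP => y.
  have [yM|] := boolP (y \in M k).
    exists k => // a; rewrite in_setU1 => /orP[/eqP->|aA]; first exact: xmax.
    have /(dominant_lowestP a0A)/(_ y)[l lC yl] := dAC.
    have lk : l = k.
      apply/eqP/negPn/negP => lk; move/MP: yM => /(_ l lC lk).
      by rewrite ltnNge yl.
    by rewrite -lk; apply: leq_trans yl _; exact: lowest_le.
  rewrite in_set negb_forall => /existsP[l].
  rewrite negb_imply -leqNgt !inE => /andP[/andP[lk lC] yl].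
  exists l => // a; rewrite in_setU1 => /orP[/eqP->|aA].
    by apply: leq_trans yl (ltnW _); exact: xM.
  by apply: leq_trans yl _; exact: lowest_le.
have Mdisj : [disjoint top i & top j].
  rewrite -setI_eq0; apply/eqP/setP => x; rewrite in_setI in_set0.
  apply/negP => /andP[/topP[/MP Mi _] /topP[/MP Mj _]].
  have /(dominant_lowestP a0A)/(_ x)[l lC] := dAC.
  rewrite leqNgt; have [->|li] := eqVneq l i; first by rewrite Mj.
  by rewrite Mi.
have ctop k : #|top k| = (M k != set0).
  have [Mk0|/set0Pn[y yM]] := eqVneq (M k) set0.
    apply/eqP; rewrite cards_eq0 -subset0; apply/subsetP => x /topP[].
    by rewrite Mk0.
  pose x := [arg max_(z > y in M k) rk k z].
  have [xM xmax] : x \in M k /\ forall z, z \in M k -> rk k z <= rk k x.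
    by rewrite /x; case: arg_maxnP.
  apply/eqP/cards1P; exists x; apply/setP => z; rewrite in_set1.
  apply/topP/eqP => [[zM zmax]|->//].
  by apply: (@rk_inj k); apply/eqP; rewrite eqn_leq xmax ?zmax.
rewrite /degree.
have -> : \sum_(x in ~: A) room (x |: A) C = (M i != set0) + (M j != set0).
  have [_] := leq_card_setU (top i) (top j).
  rewrite Mdisj -!ctop => /eqP <-.
  rewrite -sum1_card big_mkcond [RHS]big_mkcond; apply: eq_bigr => x _.
  by rewrite -roomU; case: (x \in ~: A); case: room.
have -> : \sum_(k in C) room A (C :\ k) = (M i == set0) + (M j == set0).
  rewrite (eq_bigr _ (fun k kC => congr1 nat_of_bool (roomD k kC))).
  rewrite (bigID (mem [set i; j])) /= [X in _ + X]big1 ?addn0; last first.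
    move=> k /andP[kC]; rewrite -lowCk //.
    by apply: contraNeq; rewrite eqb0 negbK -roomD // => /andP[dk _]; 
       apply/eqP; exact: (dominant_lowest_imset a0A).
  rewrite (eq_bigl (mem [set i; j])) => [|k]; last first.
    rewrite /= !inE; have [->|] := eqVneq k i; first by rewrite iC.
    by have [->|] := eqVneq k j; rewrite ?jC ?andbF.
  by rewrite big_setU1 ?inE //= big_set1.
by case: (M i == set0); case: (M j == set0).
Qed.

(** The only door without points leads outside: one of its two sides would be
    the empty pair, which is not dominant. *)
Lemma degree_set0 (t0 : T) (i : I) : degree set0 [set i] = 1.
Proof.
rewrite /degree big_set1 setDv.
have -> : room set0 set0 = false.
  by apply/negbTE/negP => /andP[/dominantP/(_ t0)[k]]; rewrite in_set0.
pose x := [arg max_(z > t0) rk i z].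
have xmax z : rk i z <= rk i x by rewrite /x; case: arg_maxnP => // y _; apply.
rewrite (bigD1 x) ?in_setC ?in_set0 //= big1 ?addn0 => [|z /andP[_ zx]].
  rewrite /room setU0 !cards1 eqxx andbT.
  suff -> : dominant [set x] [set i] by [].
  by apply/dominantP => z; exists i => [|_ /set1P->]; rewrite ?set11.
apply/eqP; rewrite eqb0; apply: contra zx => /andP[/dominantP/(_ x)[k]].
move=> /set1P -> /(_ z); rewrite setU0 set11 => /(_ isT) xz _.
by apply/eqP/(@rk_inj i)/eqP; rewrite eqn_leq xmax xz.
Qed.

Variables (c : T -> I) (i0 : I).

Definition typed A C := (i0 \in C) && (c @: A == C :\ i0).

(** A room whose colours are not exactly its orders has none or two doors that
    carry every colour of their orders except i0. *)
Lemma typed_even A C : room A C -> c @: A != C ->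
  ~~ odd (\sum_(k in ~: C) typed A (k |: C) + \sum_(a in A) typed (A :\ a) C).
Proof.
move=> /andP[_ /eqP cAC] cA.
have [i0C|i0C] := boolP (i0 \in C); last first.
  rewrite !big1 // => k; rewrite /typed ?(negPf i0C) // in_setC => kC.
  apply/eqP; rewrite eqb0 in_setU1 (negPf i0C) orbF; apply: contra cA.
  by move=> /andP[/eqP->]; rewrite setU1K.
have cB : #|A| = #|C :\ i0|.+1 by rewrite cAC (cardsD1 i0 C) i0C.
have [cAB|cAB] := eqVneq (c @: A) (C :\ i0).
  rewrite [X in X + _]big1 ?add0n => [|k]; last first.
    rewrite in_setC => kC; apply/eqP; rewrite eqb0 /typed cAB negb_and.
    apply/orP; right; apply/eqP => /setP/(_ k); rewrite !inE eqxx (negPf kC).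
    by rewrite andbF andbT => /esym/negbFE/eqP ki; rewrite ki i0C in kC.
  rewrite (eq_bigr (fun a => nat_of_bool (c @: (A :\ a) == C :\ i0))).
    by rewrite sum_imsetD1_defect1.
  by move=> a _; rewrite /typed i0C.
have typedU l : l \notin C -> typed A (l |: C) = (c @: A == l |: C :\ i0).
  move=> lC; rewrite /typed in_setU1 i0C orbT /=; congr (_ == _).
  apply/setP => x; rewrite !inE; have [->|//] := eqVneq x l.
  by rewrite andbT; apply/eqP => li; rewrite li i0C in lC.
have typedD a : typed (A :\ a) C = (c @: (A :\ a) == C :\ i0).
  by rewrite /typed i0C.
have cA_U1 a : a \in A -> c @: A = c a |: c @: (A :\ a).
  by move=> aA; rewrite -imsetU1 setD1K.
have [k /andP[kC /eqP ck]|nk] :=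
    pickP [pred k | (k \in ~: C) && (c @: A == k |: C :\ i0)]; last first.
  rewrite !big1 // => [a aA|k kC]; apply/eqP; rewrite eqb0; last first.
    by have /= := nk k; rewrite kC /= => nkE; rewrite typedU ?nkE -?in_setC.
  rewrite typedD; apply/negP => /eqP ca.
  have := nk (c a); rewrite /= (cA_U1 a aA) ca eqxx andbT in_setC.
  move=> /negbFE caC; have := cA; have := cAB; rewrite (cA_U1 a aA) ca.
  have [->|ca0] := eqVneq (c a) i0; first by rewrite setD1K // eqxx.
  by rewrite (setUidPr _) ?eqxx // sub1set !inE ca0.
have kB : k \notin C :\ i0.
  by move: kC; rewrite !inE => /negPf ->; rewrite andbF.
have cinj : {in A &, injective c}.
  by apply/imset_injP; rewrite ck cardsU1 kB cB.
have /imsetP[a aA ka] : k \in c @: A by rewrite ck setU11.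
rewrite in_setC in kC.
rewrite (bigD1 k) ?in_setC //= typedU // ck eqxx big1 ?addn0; last first.
  move=> l /andP[]; rewrite in_setC => lC lk; apply/eqP; rewrite eqb0 typedU //.
  rewrite ck; apply: contraNN lk => /eqP/setP/(_ l); rewrite setU11 in_setU1.
  by rewrite !inE (negPf lC) andbF orbF => ->.
rewrite (bigD1 a) //= typedD big1 ?addn0; last first.
  move=> b /andP[bA ba]; apply/eqP; rewrite eqb0 typedD.
  apply: contraNN kB => /eqP <-; rewrite ka imset_f // !inE aA andbT.
  by rewrite eq_sym.
suff -> : c @: (A :\ a) == C :\ i0 by [].
rewrite -(setU1K kB) -ck (cA_U1 a aA) -ka setU1K //.
apply/imsetP => -[b]; rewrite !inE => /andP[ba bA] kb.
by move: ba; rewrite (cinj b a) ?eqxx // -kb.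
Qed.

(** Count the incidences between rooms and typed doors modulo 2.  Every typed
    door has two rooms, apart from the one without points, which has a single
    room; so the total is odd.  Rooms that are not fully coloured contribute an
    even number each, hence some room is fully coloured. *)
Lemma scarf (t0 : T) :
  exists A C, room A C /\ c @: A = C.
Proof.
have [/existsP[A /existsP[C /andP[? /eqP ?]]]|] :=
  boolP [exists A : {set T}, exists C : {set I}, room A C && (c @: A == C)].
  by exists A, C.
rewrite negb_exists => /forallP noAC.
have noroom A C : room A C -> c @: A != C.
  move=> rAC; have := noAC A; rewrite negb_exists => /forallP/(_ C).
  by rewrite rAC.
(* E counts the incidences door by door, F room by room *)
pose E := \sum_(A : {set T}) \sum_(C : {set I}) typed A C * degree A C.
pose F := \sum_(A : {set T}) \sum_(C : {set I}) room A C *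
  (\sum_(k in ~: C) typed A (k |: C) + \sum_(a in A) typed (A :\ a) C).
have EF : E = F.
  rewrite /E /F /degree.
  under eq_bigr do under eq_bigr do rewrite mulnDr !big_distrr.
  under [RHS]eq_bigr do under eq_bigr do rewrite mulnDr !big_distrr.
  under eq_bigr do rewrite big_split.
  under [RHS]eq_bigr do rewrite big_split.
  rewrite !big_split; congr (_ + _).
    apply: eq_bigr => A _ /=.
    rewrite (sum_setD1_setU1 (fun C D => typed A C * room A D)).
    by apply: eq_bigr => C _; apply: eq_bigr => k _; rewrite mulnC.
  rewrite exchange_big [RHS]exchange_big; apply: eq_bigr => C _ /=.
  rewrite (sum_setD1_setU1 (fun A B => room A C * typed B C)).
  by apply: eq_bigr => A _; apply: eq_bigr => k _; rewrite mulnC.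
have odd_sum (J : finType) (G : J -> nat) :
  odd (\sum_j G j) = \big[addb/false]_j odd (G j).
  exact: (big_morph odd oddD).
have : odd F = false.
  rewrite odd_sum big1 // => A _; rewrite odd_sum big1 // => C _.
  have [rAC|] := boolP (room A C); last by rewrite mul0n.
  by rewrite mul1n; apply/negbTE/typed_even => //; exact: noroom.
rewrite -EF odd_sum (bigD1 set0) //= [X in _ (+) X]big1 ?addbF; last first.
  move=> A A0; rewrite odd_sum big1 // => C _; rewrite oddM.
  have [->|/room_doorP[dAC cAC]] := eqVneq (degree A C) 0.
    by rewrite andbF.
  by rewrite (degree_nonempty A0) // andbF.
rewrite odd_sum (bigD1 [set i0]) //= [X in _ (+) X]big1 ?addbF; last first.
  move=> C C0; rewrite oddM /typed imset0.
  have [i0C|//] := boolP (i0 \in C); have [C'|//] := eqVneq set0 (C :\ i0).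
  by move: C0; rewrite -(setD1K i0C) -C' setU0 eqxx.
by rewrite (degree_set0 t0) /typed set11 imset0 setDv eqxx.
Qed.

End Scarf.

(** * Brouwer's theorem on the standard simplex *)

Section Grid.
Import mathcomp.boot.fintype mathcomp.boot.finset.
Local Open Scope set_scope.
Local Open Scope nat_scope.

(** A discrete Brouwer theorem on the points with integer coordinates of sum N.
    In the fully coloured room (A, C) supplied by Scarf's lemma, the minima m_i
    of the coordinates over A have a sum close to N for i in C, since otherwise
    the point with coordinates m_i + 1 (i in C) would violate dominance.  As the
    coordinates of each element of A sum to N, all of A is clustered: the
    coordinates in C exceed m_i by at most n, the others are at most n. *)
Lemma grid_labelling (n N : nat)
    (col : {ffun 'I_n.+1 -> 'I_N.+1} -> 'I_n.+1) :
  exists2 x : {ffun 'I_n.+1 -> 'I_N.+1}, \sum_i x i = N &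
    forall k, x k <= n \/ exists y : {ffun 'I_n.+1 -> 'I_N.+1},
      [/\ \sum_i y i = N, col y = k
        & forall l, y l <= x l + n /\ x l <= y l + n].
Proof.
pose T : finType := {g : {ffun 'I_n.+1 -> 'I_N.+1} | \sum_i g i == N}.
have mkT (h : 'I_n.+1 -> nat) : \sum_i h i = N ->
    exists t : T, forall i, val t i = h i :> nat.
  move=> hN; have hle i : h i < N.+1 by rewrite ltnS -hN (bigD1 i) //= leq_addr.
  have gN : \sum_i [ffun i => Ordinal (hle i)] i == N.
    rewrite -[X in _ == X]hN; apply/eqP; apply: eq_bigr => i _.
    by rewrite ffunE.
  pose P (g : {ffun 'I_n.+1 -> 'I_N.+1}) := is_true (\sum_i g i == N).
  by exists (exist P _ gN) => i; rewrite /= ffunE.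
(* coordinate i first, ties being broken by an arbitrary enumeration *)
pose rk (i : 'I_n.+1) (g : T) := val g i * #|T| + enum_rank g.
have rk_inj i : injective (rk i).
  move=> g h /(congr1 (modn^~ #|T|)); rewrite !modnMDl !modn_small //.
  by move=> gh; apply: enum_rank_inj; exact: val_inj.
have rk_le i g h : rk i g <= rk i h -> val g i <= val h i.
  move=> gh; have T0 : 0 < #|T| by apply/card_gt0P; exists g.
  by move: (leq_div2r #|T| gh); rewrite !divnMDl // !divn_small // !addn0.
have [t0 _] :
    exists t : T, forall i, val t i = (if i == ord0 then N else 0) :> nat.
  by apply: mkT; rewrite -big_mkcond big_pred1_eq.
have [A [C [/andP[dAC _] cA]]] := scarf rk_inj (col \o val) ord0 t0.
have [a0 a0A] : exists a0, a0 \in A.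
  have /dominantP/(_ t0)[i iC _] := dAC.
  by move: iC; rewrite -cA => /imsetP[a aA _]; exists a.
pose m i : nat := val (lowest rk A a0 i) i.
have m_le i a : a \in A -> m i <= val a i.
  by move=> aA; apply/rk_le/lowest_le.
have m_dom (x : T) : exists2 i, i \in C & val x i <= m i.
  have /(dominant_lowestP rk a0A)/(_ x)[i iC xi] := dAC.
  by exists i => //; exact: rk_le.
have m_sum : N < \sum_(i in C) (m i).+1.
  rewrite ltnNge; apply/negP => mN.
  pose h i := (if i \in C then (m i).+1 else 0) +
              (if i == ord0 then N - \sum_(i in C) (m i).+1 else 0).
  have [] := mkT h.
    by rewrite big_split /= -!big_mkcond big_pred1_eq subnKC.
  move=> t th; have [i iC] := m_dom t.
  by rewrite th /h iC addSn ltnNge leq_addr.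
have sumN (a : T) : \sum_i \val a i = N by exact/eqP/(valP a).
have cC : #|C| <= n.+1 by have := max_card (mem C); rewrite card_ord.
have m_sumE : \sum_(i in C) (m i).+1 = \sum_(i in C) m i + #|C|.
  by rewrite -sum1_card -big_split; apply: eq_bigr => i _; rewrite /= addn1.
have slack p x u v w : u <= v ->
    N < p + u + #|C| -> x + v + w = N -> x <= p + n.
  by move: cC; lia.
have aC (a : T) i : a \in A -> i \in C -> val a i <= m i + n.
  move=> aA iC; move: m_sum (sumN a).
  rewrite m_sumE (bigD1 i) //= [in X in _ -> X -> _](bigID (mem C)) /=.
  rewrite [in X in _ -> X -> _](bigD1 i) //=.
  by apply: slack; apply: leq_sum => j _; exact: m_le.
have anC (a : T) i : a \in A -> i \notin C -> val a i <= n.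
  move=> aA iC; move: m_sum (sumN a).
  rewrite m_sumE [in X in _ -> X -> _](bigID (mem C)) /=.
  rewrite [X in _ -> _ + X = _ -> _](bigD1 i) //=.
  move=> Nm Na; apply: (slack 0 _ _ (\sum_(j in C) \val a j) _ _ Nm).
    by apply: leq_sum => j _; exact: m_le.
  by rewrite -[RHS]Na [in RHS]addnA [X in _ = X + _]addnC.
exists (val a0); first exact: sumN.
move=> k; have [kC|kC] := boolP (k \in C); last by left; exact: anC.
right; have := kC; rewrite -{1}cA => /imsetP[b bA kb].
exists (val b); split; [exact: sumN|by rewrite kb|move=> l].
have [lC|lC] := boolP (l \in C).
  by split; [apply: leq_trans (aC _ _ bA lC) _
            |apply: leq_trans (aC _ _ a0A lC) _]; rewrite leq_add2r; exact: m_le.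
by split; [apply: leq_trans (anC _ _ bA lC) _
          |apply: leq_trans (anC _ _ a0A lC) _];
  exact: leq_addl.
Qed.

End Grid.

Local Open Scope classical_set_scope.
Local Open Scope ring_scope.


Definition simplex (R : realType) (n : nat) : set 'rV[R]_n.+1 :=
  [set t | (forall i, 0 <= t 0 i) /\ \sum_i t 0 i = 1].
Arguments simplex : clear implicits.

Lemma simplex_le1 (R : realType) n (t : 'rV[R]_n.+1) i :
  simplex R n t -> t 0 i <= 1.
Proof. by move=> [t0 <-]; rewrite (bigD1 i) //= lerDl sumr_ge0. Qed.

Lemma simplex_compact (R : realType) n : compact (simplex R n).
Proof.
apply: bounded_closed_compact.
  exists 1; split => // M M1 t st /=.
  rewrite [leLHS]/Num.norm /= mx_normrE.
  apply/bigmax_leP; split => [|[i j] _] /=.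
    by rewrite ltW // (lt_trans ltr01).
  rewrite ord1 ger0_norm; last by have [] := st.
  exact: le_trans (simplex_le1 _ st) (ltW M1).
have -> : simplex R n = \bigcap_(i in [set: 'I_n.+1]) [set t | 0 <= t 0 i] `&`
    [set t | \sum_i t 0 i = 1].
  by apply/seteqP; split => t [t0 t1]; split => // i; [move=> _|]; exact: t0.
apply: closedI.
  apply: closed_bigI => i _.
  apply: (@preimage_closed _ R^o (fun t : 'rV[R]_n.+1 => t 0 i)
    [set x | 0 <= x]).
    by move=> x _; exact: coord_continuous.
  exact: closed_ge.
apply: (@preimage_closed _ R^o (fun t : 'rV[R]_n.+1 => \sum_i t 0 i) [set 1]).
  move=> x _; move: x; apply: continuous_big => [|i _].
    exact: add_continuous.
  exact: coord_continuous.
exact: closed_eq.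
Qed.

(** Without a fixed point, f strictly lowers some coordinate at each point of
    the simplex, since both coordinate sums are 1.  By continuity and
    compactness there is a single e such that, around each t, one coordinate i
    larger than e drops on the whole e-neighbourhood of t.  Label each point
    of a grid of mesh 1 / N, with n / N <= e, by a coordinate that f does not
    lower: near the point t given by [grid_labelling], either some grid point is
    labelled i, or the coordinate i of t is at most e; both are excluded. *)
Theorem brouwer_simplex (R : realType) n (f : 'rV[R]_n.+1 -> 'rV[R]_n.+1) :
  {within simplex R n, continuous f} -> f @` simplex R n `<=` simplex R n ->
  exists2 t, simplex R n t & f t = t.
Proof.
move=> cf fS; apply: contrapT => nofix.
have drop t : simplex R n t -> exists i, f t 0 i < t 0 i.
  move=> st; apply: contrapT => /forallNP fge.
  apply: nofix; exists t => //.
  have [f0 f1] : simplex R n (f t) by apply: fS; exists t.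
  have [t0 t1] := st.
  have ge i : t 0 i <= f t 0 i by rewrite leNgt; exact/negP.
  apply/rowP => i; apply/eqP; rewrite eq_le ge andbT -subr_le0.
  have -> : 0 = \sum_j (f t 0 j - t 0 j) by rewrite sumrB f1 t1 subrr.
  by rewrite (bigD1 i) //= lerDl sumr_ge0 // => j _; rewrite subr_ge0.
pose drops (e : R) (t : 'rV[R]_n.+1) := exists2 i, e < t 0 i &
  forall u, simplex R n u -> (forall j, `|t 0 j - u 0 j| <= e) ->
    f u 0 i < u 0 i.
have dropsP : \forall e \near 0^'+, simplex R n `<=` drops e.
  have /compact_near_coveringP/near_covering_withinP := @simplex_compact R n.
  apply => t st; have [i fti] := drop t st.
  have : \forall u \near within (simplex R n) (nbhs t), f u 0 i - u 0 i < 0.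
    apply: (@cvgr_lt _ _ (within (simplex R n) (nbhs t)) _
      (fun u => f u 0 i - u 0 i) (f t 0 i - t 0 i)); last by rewrite subr_lt0.
    apply: cvgB; last first.
      by apply: cvg_within_filter; exact: coord_continuous.
    apply: (@cvg_comp _ _ _ f (fun u : 'rV[R]_n.+1 => u 0 i) _ (nbhs (f t))).
      by move/subspace_continuousP: cf; exact.
    exact: coord_continuous.
  move=> /nbhs_ballP[d /= d0 dP].
  have ti0 : 0 < t 0 i.
    have [ft0 _] : simplex R n (f t) by apply: fS; exists t.
    exact: le_lt_trans fti.
  near=> t' e => /= st'; exists i.
    apply: (@lt_trans _ _ (t 0 i / 2)).
      by near: e; apply: nbhs_right_lt; rewrite divr_gt0.
    near: t'; apply: (cvgr_gt (t 0 i)); first exact: coord_continuous.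
    by rewrite ltr_pdivrMr // mulr_natr mulr2n ltrDl.
  move=> u su tu; rewrite -subr_lt0; apply: dP => //.
  split=> // a j; rewrite ord1 /ball /= (splitr d).
  rewrite -(subrKA (t' 0 j)); apply: le_lt_trans (ler_normD _ _) _.
  apply: ltr_leD.
    have : ball t (d / 2) t' by near: t'; apply: nbhsx_ballx; rewrite divr_gt0.
    by move=> [_ /(_ 0 j)].
  apply: le_trans (tu j) _.
  by near: e; apply: nbhs_right_le; rewrite divr_gt0.
have /filter_ex[e [e0 eP]] :
    \forall e \near 0^'+, 0 < e /\ simplex R n `<=` drops e.
  exact: filterI (nbhs_right_gt 0) dropsP.
have keep t : simplex R n t -> exists i, t 0 i <= f t 0 i.
  move=> st; apply: contrapT => /forallNP flt.
  have [f0 f1] : simplex R n (f t) by apply: fS; exists t.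
  have : \sum_j f t 0 j < \sum_j t 0 j.
    apply: ltr_sum => [|j _]; last by rewrite ltNge; exact/negP.
    by apply/hasP; exists ord0; rewrite ?mem_index_enum.
  by have [_ t1] := st; rewrite f1 t1 ltxx.
pose N := (Num.bound (n%:R / e : R)).+1.
have Ne : n%:R / N%:R <= e.
  rewrite ler_pdivrMr // mulrC -ler_pdivrMr //.
  apply: le_trans (ltW (archi_boundP _)) _; first by rewrite divr_ge0 // ltW.
  by rewrite ler_nat.
pose grid := {ffun 'I_n.+1 -> 'I_N.+1}.
pose p (g : grid) : 'rV[R]_n.+1 := \row_i ((g i)%:R / N%:R).
have pS (g : grid) : (\sum_i g i)%N = N -> simplex R n (p g).
  move=> gN; split => [i|]; first by rewrite mxE divr_ge0.
  under eq_bigr do rewrite mxE.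
  by rewrite -mulr_suml -natr_sum gN divff ?pnatr_eq0.
pose col g := odflt ord0 [pick i | p g 0 i <= f (p g) 0 i].
have colP (g : grid) : (\sum_i g i)%N = N ->
    p g 0 (col g) <= f (p g) 0 (col g).
  move=> gN; rewrite /col; case: pickP => [//|none].
  by have [i] := keep _ (pS _ gN); rewrite none.
have [x xN xP] := grid_labelling col.
have [i ei iP] := eP _ (pS _ xN).
have [xi|[y [yN yi yx]]] := xP i.
  move: ei; rewrite mxE ltNge (le_trans _ Ne) //.
  by rewrite ler_pM2r ?invr_gt0 // ler_nat.
have : f (p y) 0 i < p y 0 i.
  apply: iP => [|j]; first exact: pS.
  rewrite !mxE -mulrBl normrM (ger0_norm (_ : 0 <= N%:R^-1)) ?invr_ge0 //.
  apply: le_trans Ne; rewrite ler_pM2r ?invr_gt0 // ler_norml.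
  have [yxj xyj] := yx j.
  by rewrite lerBrDr addrC lerBlDr -natrD ler_nat yxj /= lerBlDl -natrD ler_nat.
by have := colP _ yN; rewrite yi leNgt => /negbTE ->.
Unshelve. all: by end_near. Qed.

(** * Closed convex hulls and Mazur's theorem *)

Lemma convex_setP (R : realType) (X : lmodType R) (A : set X) :
  convex_set A <-> forall x y (l : R), 0 <= l <= 1 -> A x -> A y ->
    A (l *: x + (1 - l) *: y).
Proof.
split=> [cA x y l /andP[l0 l1] Ax Ay|cA x y l].
  by have := cA x y (Itv01 l0 l1) (mem_set Ax) (mem_set Ay); rewrite inE.
by rewrite !inE; apply: cA; rewrite ge0 le1.
Qed.

Definition comb (R : realType) (X : lmodType R) n (z : 'I_n.+1 -> X)
  (t : 'rV[R]_n.+1) : X := \sum_i t 0 i *: z i.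

(** Only the points of positive weight need to lie in A; this is what localises
    the convex combinations that come from a partition of unity. *)
Lemma convex_comb (R : realType) (X : lmodType R) n (z : 'I_n.+1 -> X)
    (t : 'rV[R]_n.+1) (A : set X) :
  convex_set A -> simplex R n t -> (forall i, 0 < t 0 i -> A (z i)) ->
  A (comb z t).
Proof.
move=> /convex_setP cA [t0 t1] zA.
(* partial sums have to be renormalised for the induction to go through *)
suff H (r : seq 'I_n.+1) : 0 < \sum_(i <- r) t 0 i ->
    A ((\sum_(i <- r) t 0 i)^-1 *: \sum_(i <- r) t 0 i *: z i).
  by have := H (index_enum 'I_n.+1); rewrite t1 invr1 scale1r; apply.
elim: r => [|i r IHr]; first by rewrite big_nil ltxx.
rewrite !big_cons; have := t0 i; rewrite le_eqVlt => /predU1P[<-|ti].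
  by rewrite add0r scale0r add0r.
have [s0 _|s0 _] := leP (\sum_(j <- r) t 0 j) 0.
  have tr j : j \in r -> t 0 j = 0.
    move=> jr; apply/eqP; rewrite eq_le t0 andbT; apply: le_trans s0.
    by rewrite (big_rem j) //= lerDl sumr_ge0.
  rewrite [\sum_(j <- r) t 0 j]big_seq [\sum_(j <- r) t 0 j *: _]big_seq.
  rewrite !big1 ?addr0 => [|j /tr ->|j /tr ->]; rewrite ?scale0r //.
  by rewrite scalerA mulVf ?gt_eqF // scale1r; exact: zA.
move/(_ s0) : IHr.
set s := \sum_(j <- r) t 0 j in s0 *; set v := \sum_(j <- r) _ => Av.
have ts : 0 < t 0 i + s by rewrite addr_gt0.
have -> : (t 0 i + s)^-1 *: (t 0 i *: z i + v) =
    (t 0 i / (t 0 i + s)) *: z i + (1 - t 0 i / (t 0 i + s)) *: (s^-1 *: v).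
  rewrite scalerDr !scalerA mulrC; congr (_ + _ *: _).
  by field; rewrite !gt_eqF.
apply: cA => //; last exact: zA.
by rewrite divr_ge0 ?ler_pdivrMr ?mul1r ?lerDl // ltW.
Qed.

Section ClosedConvexHull.
Variables (R : realType) (X : normedModType R).
Implicit Types A B : set X.

Lemma sub_closed_convex_hull A : A `<=` closed_convex_hull A.
Proof. exact: sub_gen_smallest. Qed.

Lemma closed_convex_hull_min A B : closed B -> convex_set B -> A `<=` B ->
  closed_convex_hull A `<=` B.
Proof. by move=> cB vB; exact: smallest_sub. Qed.

Lemma closed_convex_hull_closed A : closed (closed_convex_hull A).
Proof. by apply: closed_bigI => C [[]]. Qed.

Lemma closed_convex_hull_convex A : convex_set (closed_convex_hull A).
Proof.
apply/convex_setP => x y l l01 Ax Ay C CA.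
have [[_ /convex_setP vC] _] := CA.
by apply: vC => //; [exact: Ax|exact: Ay].
Qed.

Lemma closed_convex_hullS A B : A `<=` B ->
  closed_convex_hull A `<=` closed_convex_hull B.
Proof.
move=> AB; apply: closed_convex_hull_min.
- exact: closed_convex_hull_closed.
- exact: closed_convex_hull_convex.
- exact: subset_trans (@sub_closed_convex_hull B).
Qed.

Lemma comb_continuous n (z : 'I_n.+1 -> X) : continuous (comb z).
Proof.
apply: continuous_big => [|i _ t]; first exact: add_continuous.
by apply: continuousZr_tmp; exact: coord_continuous.
Qed.

Lemma compact_finite_net A (e : R) : compact A -> A !=set0 -> 0 < e ->
  exists n (z : 'I_n.+1 -> X), (forall i, A (z i)) /\
    forall x, A x -> exists i, `|z i - x| < e.
Proof.
move=> cA [x0 Ax0] e0; move: cA; rewrite compact_cover.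
move=> /(_ X A (fun z => ball z e)) [z Az|x Ax|D DA Acov].
- exact: ball_open.
- by exists x => //; exact: ballxx.
pose s : seq X := finmap.enum_fset D.
have s0 : (0 < size s)%N.
  have [z /= zs _] := Acov _ Ax0.
  by have : z \in s by []; case: s.
exists (size s).-1, (fun i => nth x0 s i).
have sz : (size s).-1.+1 = size s by rewrite prednK.
split=> [i|x /Acov[z /= zs zx]].
  have si : nth x0 s i \in s.
    by apply: mem_nth; apply: leq_trans (ltn_ord i) _; rewrite sz.
  exact: set_mem (DA _ si).
have iz : (index z s < (size s).-1.+1)%N by rewrite sz index_mem.
exists (Ordinal iz); rewrite /= nth_index //.
by move: zx; rewrite -ball_normE.
Qed.

Lemma closed_thickening A (e : R) : compact A ->
  closed [set x | exists2 y, A y & `|x - y| <= e].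
Proof.
move=> /compact_near_coveringP cA; rewrite -openC openE => x /= /forall2NP xA.
apply: (filterS (P := [set x' | A `<=` (fun y => e < `|x' - y|)])).
  by move=> x' + [y Ay]; rewrite leNgt => /(_ y Ay)/= ->.
apply: cA => y Ay; have {xA}xy : e < `|x - y|.
  by have [//|] := xA y; rewrite ltNge => /negP.
pose d := (`|x - y| - e) / 2.
have d0 : 0 < d by rewrite divr_gt0 // subr_gt0.
near=> y' x' => /=.
have : `|y - y'| < d by near: y'; apply: cvgr_dist_lt.
have : `|x - x'| < d by near: x'; apply: cvgr_dist_lt.
have := ler_distD x' x y; have := ler_distD y' x' y; rewrite (distrC y' y).
rewrite /d; lra.
Unshelve. all: by end_near. Qed.

Lemma comb_simplex_convex n (z : 'I_n.+1 -> X) :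
  convex_set (comb z @` simplex R n).
Proof.
apply/convex_setP => _ _ l /andP[l0 l1] [t [t0 t1] <-] [u [u0 u1] <-].
exists (l *: t + (1 - l) *: u).
  split => [i|].
    by rewrite !mxE addr_ge0 // mulr_ge0 // subr_ge0.
  under eq_bigr do rewrite !mxE.
  by rewrite big_split -!mulr_sumr /= t1 u1 !mulr1 subrKC.
rewrite /comb !scaler_sumr -big_split; apply: eq_bigr => i _ /=.
by rewrite !mxE !scalerA -scalerDl.
Qed.

End ClosedConvexHull.

(** The hull is closed in a complete space, so it suffices to see that it is
    totally bounded: given e, the hull of a finite e-net of cl A is compact, as a
    continuous image of a simplex, and its closed e-neighbourhood is closed and
    convex, hence contains the closed convex hull of A.  Total boundedness is
    used on an ultrafilter U: if no ball of radius e belonged to U, compactness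
    of that finite-dimensional hull F would yield a set of U far from F. *)
Lemma mazur (R : realType) (X : completeNormedModType R) (A : set X) :
  A !=set0 -> precompact A -> compact (closed_convex_hull A).
Proof.
move=> A0; rewrite precompactE => cA.
have net (e : R) : 0 < e -> exists2 F : set X, compact F &
    forall x, closed_convex_hull A x -> exists2 y, F y & `|x - y| <= e.
  move=> e0; have clA0 : closure A !=set0.
    by have [a Aa] := A0; exists a; exact: subset_closure.
  have [n [z [_ zA]]] := compact_finite_net cA clA0 e0.
  exists (comb z @` simplex R n).
    apply: continuous_compact; last exact: simplex_compact.
    exact/continuous_subspaceT/comb_continuous.
  apply: closed_convex_hull_min.
  - apply: closed_thickening; apply: continuous_compact.
      exact/continuous_subspaceT/comb_continuous.
    exact: simplex_compact.
  - apply/convex_setP => x x' l /[dup] l01 /andP[l0 l1] [y Fy xy] [y' Fy' xy'].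
    exists (l *: y + (1 - l) *: y').
      by have /convex_setP := @comb_simplex_convex _ _ n z; apply.
    rewrite opprD addrACA -!scalerBr (le_trans (ler_normD _ _)) //.
    rewrite !normrZ ger0_norm // ger0_norm ?subr_ge0 //.
    have -> : e = l * e + (1 - l) * e by ring.
    by rewrite lerD // ler_wpM2l // subr_ge0.
  - move=> x Ax; have [i zi] := zA x (subset_closure Ax).
    exists (z i); last by rewrite distrC ltW.
    exists (\row_j (j == i)%:R).
      split => [j|]; first by rewrite mxE.
      under eq_bigr do rewrite mxE.
      by rewrite (bigD1 i) //= eqxx big1 ?addr0 // => j /negPf ->.
    rewrite /comb (bigD1 i) //= mxE eqxx scale1r big1 ?addr0 // => j /negPf ji.
    by rewrite mxE ji scale0r.
rewrite compact_ultra => U UU UK.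
have cauchyU : cauchy U.
  apply: cauchy_exP => e e0; apply: contrapT => /forallNP noball.
  have e4 : 0 < e / 4 by rewrite divr_gt0.
  have [F /compact_near_coveringP cF FK] := net _ e4.
  have far : \forall x \near U, F `<=` (fun y => e / 4 < `|x - y|).
    apply: cF => y Fy; near=> y' x => /=.
    have : `|y - y'| < e / 4 by near: y'; apply: cvgr_dist_lt.
    have : e <= `|x - y|.
      near: x; have [/noball//|] := in_ultra_setVsetC (ball y e) UU.
      by apply: filterS => x; rewrite -ball_normE /= distrC leNgt => /negP.
    have := ler_distD y' x y; rewrite (distrC y' y).
    lra.
  have /filter_ex[x [Kx xF]] :
      \forall x \near U, closed_convex_hull A x /\
        F `<=` (fun y => e / 4 < `|x - y|).
    exact: filterI.
  by have [y Fy] := FK x Kx; rewrite leNgt (xF y Fy).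
have Ucvg : cvg U by exact: cauchy_cvg.
exists (lim U); split; last exact: Ucvg.
apply: (@closed_convex_hull_closed _ _ A) => V /Ucvg UV.
have /filter_ex[x KVx] : U (closed_convex_hull A `&` V) by exact: filterI.
by exists x.
Unshelve. all: by end_near. Qed.

Lemma continuous_row (R : realType) (S : topologicalType) n
    (f : S -> 'I_n -> R) (x : S) :
  (forall i, {for x, continuous (f ^~ i)}) ->
  {for x, continuous (fun x => \row_i f x i)}.
Proof.
move=> fx; apply/cvg_ballP => e e0.
have : \forall x' \near x, forall i, ball (f x i) e (f x' i).
  by apply: filter_forall => i; move/cvg_ballP: (fx i); apply.
by apply: filterS => x' fxx'; split => // a i; rewrite !mxE.
Qed.

(** * Fixed points of envelopes modulo a retraction *)

(** Schauder's projection argument: Brouwer's theorem is applied to the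
    barycentric coordinates with respect to the points T z_i, where the z_i form
    a finite e-net of rho(K).  The weights w i x vanish at distance at least e
    from z_i, so the fixed combination uses only values of T near rho y. *)
Lemma approx_envelope_fixed (R : realType) (X : normedModType R)
    (D K : set X) (T rho : X -> X) (e : R) :
  continuous rho -> compact K -> convex_set K -> K !=set0 ->
  rho @` K `<=` D -> T @` D `<=` K -> 0 < e ->
  exists2 y, K y & closed_convex_hull (T @` (closed_ball (rho y) e `&` D)) y.
Proof.
move=> crho cK vK [y0 Ky0] rhoD TD e0.
have crhoK : compact (rho @` K).
  by apply: continuous_compact => //; exact: continuous_subspaceT.
have rhoK0 : rho @` K !=set0 by exists (rho y0); exists y0.
have [n [z [zK zP]]] := compact_finite_net crhoK rhoK0 e0.
pose w i x : R := Num.max 0 (e - `|z i - x|).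
have w_ge0 i x : 0 <= w i x by rewrite /w le_max lexx.
have w_gt0 i x : (0 < w i x) = (`|z i - x| < e).
  by rewrite /w lt_max ltxx subr_gt0.
have cw i : continuous (w i).
  move=> x; apply: (@continuous_max _ _ (cst 0) (fun x => e - `|z i - x|)).
    exact: cst_continuous.
  apply: cvgB; first exact: cvg_cst.
  by apply: cvg_norm; apply: cvgB; [exact: cvg_cst|exact: cvg_id].
pose s x := \sum_i w i x.
have cs : continuous s.
  by apply: continuous_big => [|i _]; [exact: add_continuous|exact: cw].
pose y (t : 'rV[R]_n.+1) := comb (T \o z) t.
have Ky t : simplex R n t -> K (y t).
  move=> st; apply: convex_comb => // i _.
  by apply: TD; exists (z i) => //; exact: rhoD.
have s_gt0 t : simplex R n t -> 0 < s (rho (y t)).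
  move=> st; have [|i zi] := zP (rho (y t)).
    by exists (y t) => //; exact: Ky.
  by rewrite /s (bigD1 i) //= ltr_pwDl ?w_gt0 // sumr_ge0.
pose g (t : 'rV[R]_n.+1) := \row_i (w i (rho (y t)) / s (rho (y t))).
have crhoy (h : X -> R) : continuous h -> continuous (fun t => h (rho (y t))).
  move=> ch t; apply: (@continuous_comp _ _ _ (rho \o y) h); last exact: ch.
  by apply: continuous_comp; [exact: comb_continuous|exact: crho].
have [||t st gt] := @brouwer_simplex R n g.
- apply: continuous_in_subspaceT => t /set_mem st; apply: continuous_row => i.
  apply: (@continuousM _ _ (fun t => w i (rho (y t)))
    (fun t => (s (rho (y t)))^-1)); first exact: crhoy.
  by apply: continuousV; [rewrite gt_eqF // s_gt0|exact: crhoy].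
- move=> _ [t st <-]; split => [i|].
    by rewrite mxE divr_ge0 // ltW // s_gt0.
  under eq_bigr do rewrite mxE.
  by rewrite -mulr_suml divff // gt_eqF // s_gt0.
exists (y t); first exact: Ky.
apply: convex_comb => // [|i]; first exact: closed_convex_hull_convex.
rewrite -{1}gt mxE pmulr_lgt0 ?invr_gt0 ?s_gt0 // w_gt0 => zi.
apply: sub_closed_convex_hull; exists (z i) => //; split; last exact: rhoD.
by rewrite closed_ballE // /closed_ball_ /= distrC ltW.
Qed.

(** The hulls over balls of radius e shrink with e, and a point outside the hull
    for one radius stays outside when the point and the centre move slightly
    and the radius is halved.  If no y worked, then by compactness some e would
    exclude every y in K, against [approx_envelope_fixed]. *)
Lemma cc_envelope_fixed (R : realType) (X : normedModType R)
    (U K : set X) (T rho : X -> X) :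
  continuous rho -> compact K -> convex_set K -> K !=set0 ->
  rho @` K `<=` closure U -> T @` closure U `<=` K ->
  exists2 y, K y & cc_envelope U T (rho y) y.
Proof.
move=> crho cK vK K0 rhoU TU; apply: contrapT => nofix.
pose misses (e : R) y :=
  ~ closed_convex_hull (T @` (closed_ball (rho y) e `&` closure U)) y.
have missesP : \forall e \near 0^'+, K `<=` misses e.
  have /compact_near_coveringP := cK; apply => y Ky.
  have [d /= d0 yd] : exists2 d : R, 0 < d &
      misses d y.
    apply: contrapT => H; apply: nofix; exists y => // d /= d0.
    by apply: contrapT => yd; apply: H; exists d.
  near=> y' e => /= y'e.
  pose H := closed_convex_hull (T @` (closed_ball (rho y) d `&` closure U)).
  have : (~` H) y'.
    near: y'; apply: (@open_nbhs_nbhs _ _ (~` H)); split; last exact: yd.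
    exact: (closed_openC (@closed_convex_hull_closed _ _ _)).
  apply; apply: closed_convex_hullS y'e; apply: image_subset; apply: setSI.
  have e0 : 0 < e by near: e; exact: nbhs_right_gt.
  rewrite !closed_ballE // /closed_ball_ => x /= xe.
  have : `|rho y - rho y'| < d / 2.
    by near: y'; apply: cvgr_dist_lt; [exact: crho|rewrite divr_gt0].
  have : e < d / 2 by near: e; apply: nbhs_right_lt; rewrite divr_gt0.
  have := ler_distD (rho y') (rho y) x; lra.
have /filter_ex[e [e0 eK]] : \forall e \near 0^'+, 0 < e /\ K `<=` misses e.
  exact: filterI (nbhs_right_gt 0) missesP.
have [y Ky ye] := approx_envelope_fixed crho cK vK K0 rhoU TU e0.
exact: (eK y).
Unshelve. all: by end_near. Qed.

(** * The radial retraction and the main theorem *)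

Definition radial_retraction (R : realType) (X : normedModType R) (r : R)
  (y : X) : X := (r / Num.max r `|y|) *: y.

Section RadialRetraction.
Variables (R : realType) (X : normedModType R) (r : R).
Hypothesis r_gt0 : 0 < r.
Let rho : X -> X := radial_retraction r.

Let max_gt0 (y : X) : 0 < Num.max r `|y|.
Proof. by rewrite lt_max r_gt0. Qed.

Lemma radial_retraction_continuous : continuous rho.
Proof.
move=> y; apply: cvgZ; last exact: cvg_id.
apply: cvgM; first exact: cvg_cst.
apply: cvgV; first by rewrite gt_eqF.
apply: (@continuous_max _ _ (cst r) (fun y => `|y|)).
  exact: cst_continuous.
exact: norm_continuous.
Qed.

Let norm_radial_retraction y : `|rho y| = r / Num.max r `|y| * `|y|.
Proof. by rewrite normrZ ger0_norm // divr_ge0 // ltW. Qed.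

Lemma radial_retraction_le y : `|rho y| <= r.
Proof.
rewrite norm_radial_retraction mulrAC ler_pdivrMr //.
by rewrite ler_pM2l // le_max lexx orbT.
Qed.

Lemma radial_retraction_id y : `|y| <= r -> rho y = y.
Proof.
by move=> yr; rewrite /rho /radial_retraction max_l // divff ?gt_eqF // scale1r.
Qed.

Lemma radial_retraction_out y : r < `|y| -> `|rho y| = r.
Proof.
move=> ry; rewrite norm_radial_retraction max_r; last exact: ltW.
by rewrite divfK // gt_eqF // (lt_trans r_gt0).
Qed.

End RadialRetraction.

Lemma cc_envelopeS (R : realType) (X : normedModType R) (U V : set X)
    (T : X -> X) x :
  closure U `<=` closure V -> cc_envelope U T x `<=` cc_envelope V T x.
Proof.
move=> UV y Uy e e0; apply: closed_convex_hullS (Uy e e0).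
by apply: image_subset; exact: setIS.
Qed.

Theorem theorem4p5 (R : realType) (X : completeNormedModType R) (T : X -> X)
    (Tcompact : forall A : set X, bounded_set A -> precompact (T @` A))
    (r : R) (r_gt0 : 0 < r)
    (apriori : forall (x : X) (s : R), 0 <= s <= 1 ->
      [set s *: y | y in cc_envelope setT T x] x -> `|x| < r) :
  let Omega : set X := ball (0 : X) r in
  (forall x : X,
    (closure Omega `&` \bigcup_(z in closure Omega) cc_envelope Omega T z) x ->
    [set x] `&` cc_envelope Omega T x `<=` [set T x]) ->
  exists2 x : X, ball (0 : X) r x & T x = x.
Proof.
move=> Omega fixOmega.
have OmegaE : closure Omega = [set x | `|x| <= r].
  rewrite closure_ballE closed_ballE //; apply/seteqP.
  by split => x; rewrite /closed_ball_ /= sub0r normrN.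
pose K := closed_convex_hull (T @` closure Omega).
have D0 : closure Omega 0 by rewrite OmegaE /= normr0 ltW.
have TD0 : T @` closure Omega !=set0 by exists (T 0); exists 0.
have cK : compact K.
  apply: mazur => //; apply: Tcompact; exists r; split; first exact: num_real.
  by move=> M rM x; rewrite OmegaE /= => xr; apply: le_trans xr (ltW rM).
have rhoK : radial_retraction r @` K `<=` closure Omega.
  by move=> _ [y _ <-]; rewrite OmegaE /=; exact: radial_retraction_le.
have K0 : K !=set0 by exists (T 0); apply: sub_closed_convex_hull; exists 0.
have [y Ky yrho] := cc_envelope_fixed (radial_retraction_continuous r_gt0) cK
  (@closed_convex_hull_convex _ _ _) K0 rhoK (@sub_closed_convex_hull _ _ _).
have yrhoT : cc_envelope setT T (radial_retraction r y) y.
  by apply: cc_envelopeS yrho; rewrite closureT.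
have [yr|ry] := leP `|y| r; last first.
  have : `|radial_retraction r y| < r.
    apply: (apriori _ (r / Num.max r `|y|)); last by exists y.
    rewrite ler_pdivrMr ?lt_max ?r_gt0 // mul1r le_max lexx andbT.
    by rewrite divr_ge0 ?le_max ?(ltW r_gt0).
  by rewrite radial_retraction_out // ltxx.
rewrite (radial_retraction_id r_gt0 yr) in yrho yrhoT.
have yD : closure Omega y by rewrite OmegaE.
exists y.
  rewrite -ball_normE /= sub0r normrN; apply: (apriori y 1).
    by rewrite ler01 lexx.
  by exists y => //; rewrite scale1r.
by symmetry; apply: (fixOmega y); [split=> //; exists y|split].
Qed.
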